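(* Let $X$ and $Y$ be nontrivial real Banach spaces with the strong diameter 2 property and $N$ an absolute normalized norm on $\mathbb{R}^2$. Then $X\oplus_N Y$ has the strong diameter 2 property if and only if $(\mathbb{R}^2,N)$ has the positive strong diameter 2 property.
   Context: For a Banach space $X$, $B_X$ is its closed unit ball and $S_X$ its unit sphere. A slice of $B_X$ is a set $S(B_X,x^\ast,\alpha)=\{x\in B_X: x^\ast(x)>1-\alpha\}$ with $x^\ast\in S_{X^\ast}$ and $\alpha>0$. A convex combination of slices is a set $\sum_{i=1}^n\lambda_iS_i$ (Minkowski sum), where $n\in\mathbb{N}$, $\lambda_1,\dots,\lambda_n\ge0$, $\sum_{i=1}^n\lambda_i=1$, and $S_1,\dots,S_n$ are slices of $B_X$. $X$ has the strong diameter 2 property if the diameter of every convex combination of slices of $B_X$ is $2$. A norm $N$ on $\mathbb{R}^2$ is absolute if $N(a,b)=N(|a|,|b|)$ for all $(a,b)\in\mathbb{R}^2$, and normalized if $N(1,0)=N(0,1)=1$; its dual norm is $N^\ast(c,d)=\max_{N(a,b)\leq1}(|ac|+|bd|)$. Elements $(c,d)$ of $(\mathbb{R}^2,N^\ast)$ act as functionals by $(c,d)(a,b)=ca+db$. $X\oplus_N Y$ is $X\times Y$ with the norm $\|(x,y)\|_N=N(\|x\|,\|y\|)$. An element $(a,b)\in\mathbb{R}^2$ is positive if $a,b\ge0$. $(\mathbb{R}^2,N)$ has the positive strong diameter 2 property if whenever $n\in\mathbb{N}$, $f_1,\dots,f_n\in S_{(\mathbb{R}^2,N^\ast)}$ are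 positive, $\alpha_1,\dots,\alpha_n>0$, and $\lambda_1,\dots,\lambda_n\geq0$ with $\sum_{i=1}^n\lambda_i=1$, there are positive $(a_i,b_i)\in S(B_{(\mathbb{R}^2,N)},f_i,\alpha_i)$ such that $N\big(\sum_{i=1}^n\lambda_i(a_i,b_i)\big)=1$. A Banach space is nontrivial if it is not $\{0\}$. *)

(* Defs.v *)
From HB Require Import structures.
From mathcomp Require Import all_boot all_order all_algebra.
From mathcomp Require Import all_classical all_reals all_analysis.
From mathcomp Require Import ring lra.
Set Implicit Arguments.
Unset Strict Implicit.
Unset Printing Implicit Defensive.
Import Order.TTheory GRing.Theory Num.Theory.
Import numFieldNormedType.Exports.
Local Open Scope classical_set_scope.
Local Open Scope ring_scope.

Record abs_norm (R : realType) := AbsNorm {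
  abs_norm_fun :> R * R -> R;
  abs_normD : forall p q, abs_norm_fun (p + q) <= abs_norm_fun p + abs_norm_fun q;
  abs_normZ : forall (t : R) p, abs_norm_fun (t *: p) = `|t| * abs_norm_fun p;
  abs_norm0_eq0 : forall p, abs_norm_fun p = 0 -> p = 0;
  abs_norm_absolute : forall a b, abs_norm_fun (a, b) = abs_norm_fun (`|a|, `|b|);
  abs_norm10 : abs_norm_fun (1, 0) = 1;
  abs_norm01 : abs_norm_fun (0, 1) = 1 }.

Section AbsNormTheory.
Context (R : realType) (N : abs_norm R).

Lemma abs_norm_ge0 p : 0 <= N p.
Proof.
have := abs_normD N p (- p).
rewrite subrr -scaleN1r abs_normZ normrN normr1 mul1r.
have -> : (0 : R * R) = (0 : R) *: (0 : R * R) by rewrite scale0r.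
by rewrite abs_normZ normr0 mul0r; lra.
Qed.

Lemma abs_norm_monol (a a' b : R) : 0 <= a -> a <= a' -> N (a, b) <= N (a', b).
Proof.
move=> a0 aa'; have [a'0|a'0] := eqVneq a' 0.
  by have -> : a = a' by lra.
have a'p : 0 < a' by rewrite lt_neqAle eq_sym a'0 (le_trans a0).
pose t := (1 + a / a') / 2.
have r0 : 0 <= a / a' by rewrite divr_ge0 // ltW.
have r1 : a / a' <= 1 by rewrite ler_pdivrMr // mul1r.
have -> : (a, b) = t *: (a', b) + (1 - t) *: (- a', b).
  congr (_, _); rewrite /= /GRing.scale /= /t; last by ring.
  by field.
apply: (le_trans (abs_normD _ _ _)); rewrite !abs_normZ.
have -> : N (- a', b) = N (a', b).
  by rewrite [LHS]abs_norm_absolute normrN -abs_norm_absolute.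
rewrite !ger0_norm /t; lra.
Qed.

Lemma abs_norm_monor (a b b' : R) : 0 <= b -> b <= b' -> N (a, b) <= N (a, b').
Proof.
move=> b0 bb'; have [b'0|b'0] := eqVneq b' 0.
  by have -> : b = b' by lra.
have b'p : 0 < b' by rewrite lt_neqAle eq_sym b'0 (le_trans b0).
pose t := (1 + b / b') / 2.
have r0 : 0 <= b / b' by rewrite divr_ge0 // ltW.
have r1 : b / b' <= 1 by rewrite ler_pdivrMr // mul1r.
have -> : (a, b) = t *: (a, b') + (1 - t) *: (a, - b').
  congr (_, _); rewrite /= /GRing.scale /= /t; first by ring.
  by field.
apply: (le_trans (abs_normD _ _ _)); rewrite !abs_normZ.
have -> : N (a, - b') = N (a, b').
  by rewrite [LHS]abs_norm_absolute normrN -abs_norm_absolute.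
rewrite !ger0_norm /t; lra.
Qed.

Lemma abs_norm_mono (a a' b b' : R) :
  0 <= a -> a <= a' -> 0 <= b -> b <= b' -> N (a, b) <= N (a', b').
Proof.
move=> *; apply: (@le_trans _ _ (N (a', b))); first exact: abs_norm_monol.
exact: abs_norm_monor.
Qed.

Lemma abs_norm_l (a : R) : 0 <= a -> N (a, 0) = a.
Proof.
move=> a0; have -> : (a, 0) = a *: (1, 0) :> R * R.
  by congr (_, _); rewrite /GRing.scale /= ?mulr1 ?mulr0.
by rewrite abs_normZ abs_norm10 mulr1 ger0_norm.
Qed.

Lemma abs_norm_r (b : R) : 0 <= b -> N (0, b) = b.
Proof.
move=> b0; have -> : (0, b) = b *: (0, 1) :> R * R.
  by congr (_, _); rewrite /GRing.scale /= ?mulr1 ?mulr0.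
by rewrite abs_normZ abs_norm01 mulr1 ger0_norm.
Qed.

Lemma abs_norm_ge_l (a b : R) : 0 <= a -> 0 <= b -> a <= N (a, b).
Proof. by move=> a0 b0; rewrite -{1}(abs_norm_l a0) abs_norm_mono. Qed.

Lemma abs_norm_ge_r (a b : R) : 0 <= a -> 0 <= b -> b <= N (a, b).
Proof. by move=> a0 b0; rewrite -{1}(abs_norm_r b0) abs_norm_mono. Qed.

Lemma abs_norm_le_add (a b : R) : 0 <= a -> 0 <= b -> N (a, b) <= a + b.
Proof.
move=> a0 b0; have -> : (a, b) = (a, 0) + (0, b) by congr (_, _); rewrite /= ?addr0 ?add0r.
by apply: (le_trans (abs_normD _ _ _)); rewrite abs_norm_l ?abs_norm_r.
Qed.

End AbsNormTheory.

(* [X * Y] already carries the max norm, hence the alias. *)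
Definition abs_sum (R : realType) (N : abs_norm R) (X Y : completeNormedModType R)
  : Type := (X * Y)%type.

Section AbsSum.
Context (R : realType) (N : abs_norm R) (X Y : completeNormedModType R).
Local Notation Z := (abs_sum N X Y).

HB.instance Definition _ := GRing.Lmodule.copy Z (X * Y)%type.

Definition abs_sum_norm (z : Z) : R := N (`|z.1|, `|z.2|).

Lemma abs_sum_normD (z w : Z) :
  abs_sum_norm (z + w) <= abs_sum_norm z + abs_sum_norm w.
Proof.
apply: le_trans (abs_normD N (`|z.1|, `|z.2|) (`|w.1|, `|w.2|)).
by apply: abs_norm_mono => //=; exact: ler_normD.
Qed.

Lemma abs_sum_normZ (l : R) (z : Z) :
  abs_sum_norm (l *: z) = `|l| * abs_sum_norm z.
Proof.
by rewrite /abs_sum_norm !normrZ -[in RHS](normr_id l) -abs_normZ.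
Qed.

Lemma abs_sum_norm0_eq0 (z : Z) : abs_sum_norm z = 0 -> z = 0.
Proof.
by move=> /abs_norm0_eq0; case: z => x y /= -[/normr0_eq0 -> /normr0_eq0 ->].
Qed.

HB.instance Definition _ := Lmodule_isNormed.Build R Z
  abs_sum_normD abs_sum_normZ abs_sum_norm0_eq0.

Lemma abs_sum_complete (F : set_system Z) :
  ProperFilter F -> cauchy F -> cvg F.
Proof.
move=> FF Fc.
have Fc' e : 0 < e -> \forall z \near F & w \near F, `|z - w| < e.
  move=> e0; have /cauchy_ballP /(_ e e0) := Fc.
  by apply: filterS => -[z w] /=; rewrite -ball_normE.
have le1 (z : Z) : `|z.1| <= `|z| by exact: abs_norm_ge_l.
have le2 (z : Z) : `|z.2| <= `|z| by exact: abs_norm_ge_r.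
have /cvg_ex[l1 /cvgrPdist_lt F1] : cvg ((fst : Z -> X) @ F).
  apply/cauchy_cvgP/cauchy_ballP => e e0.
  rewrite near_map2; apply: filterS (Fc' _ e0) => -[z w] /=.
  by rewrite -ball_normE; exact: (le_lt_trans (le1 (z - w))).
have /cvg_ex[l2 /cvgrPdist_lt F2] : cvg ((snd : Z -> Y) @ F).
  apply/cauchy_cvgP/cauchy_ballP => e e0.
  rewrite near_map2; apply: filterS (Fc' _ e0) => -[z w] /=.
  by rewrite -ball_normE; exact: (le_lt_trans (le2 (z - w))).
apply/cvg_ex; exists (l1, l2); apply/cvgrPdist_lt => e e0.
have e20 : 0 < e / 2 by rewrite divr_gt0.
near=> z; apply: (@le_lt_trans _ _ (`|l1 - z.1| + `|l2 - z.2|)).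
  exact: abs_norm_le_add.
rewrite (splitr e) ltrD //; near: z; [exact: F1|exact: F2].
Unshelve. all: by end_near.
Qed.

HB.instance Definition _ := Uniform_isComplete.Build Z abs_sum_complete.

End AbsSum.

Lemma abs_sum_normE (R : realType) (N : abs_norm R) (X Y : completeNormedModType R)
    (z : (abs_sum N X Y : completeNormedModType R)) :
  `|z| = N (`|z.1|, `|z.2|).
Proof. by []. Qed.

(* For an unbounded set [sup] returns the junk value 0, so [opnorm f] is the
   operator norm only for bounded [f]; [dual_sphere] requires continuity. *)
Definition opnorm (R : realType) (X : completeNormedModType R)
    (f : {linear X -> R^o}) : R :=
  sup [set `|f x| | x in [set x : X | `|x| <= 1]].

Definition dual_sphere (R : realType) (X : completeNormedModType R)
    (f : {linear X -> R^o}) : Prop :=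
  continuous f /\ opnorm f = 1.

Definition slice (R : realType) (X : completeNormedModType R)
    (f : {linear X -> R^o}) (alpha : R) : set X :=
  [set x | `|x| <= 1 /\ 1 - alpha < f x].

Definition is_slice (R : realType) (X : completeNormedModType R) (S : set X) :=
  exists (f : {linear X -> R^o}) (alpha : R), dual_sphere f /\ 0 < alpha /\ S = slice f alpha.

Definition minkowski_comb (R : realType) (X : completeNormedModType R) (n : nat)
    (lam : 'I_n -> R) (S : 'I_n -> set X) : set X :=
  [set \sum_(i < n) lam i *: x i | x in [set x | forall i, S i (x i)]].

Definition is_convex_comb_slices (R : realType) (X : completeNormedModType R)
    (C : set X) :=
  exists (n : nat) (lam : 'I_n -> R) (S : 'I_n -> set X),
    (forall i, 0 <= lam i) /\ \sum_(i < n) lam i = 1 /\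
    (forall i, is_slice (S i)) /\ C = minkowski_comb lam S.

Definition diam (R : realType) (X : completeNormedModType R) (C : set X) : \bar R :=
  ereal_sup [set `|x.1 - x.2|%:E | x in C `*` C].

Definition strong_diam2 (R : realType) (X : completeNormedModType R) :=
  forall C : set X, is_convex_comb_slices C -> diam C = 2%:E.

Definition nontrivial (R : realType) (X : completeNormedModType R) :=
  exists x : X, x != 0.

Definition dual_abs_norm (R : realType) (N : abs_norm R) (f : R * R) : R :=
  sup [set `|p.1 * f.1| + `|p.2 * f.2| | p in [set p | N p <= 1]].

Definition positive2 (R : realType) (p : R * R) := 0 <= p.1 /\ 0 <= p.2.

Definition slice2 (R : realType) (N : abs_norm R) (f : R * R) (alpha : R)
  : set (R * R) :=
  [set p | N p <= 1 /\ 1 - alpha < f.1 * p.1 + f.2 * p.2].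

Definition positive_strong_diam2 (R : realType) (N : abs_norm R) :=
  forall (n : nat) (f : 'I_n -> R * R) (alpha lam : 'I_n -> R),
    (forall i, dual_abs_norm N (f i) = 1 /\ positive2 (f i)) ->
    (forall i, 0 < alpha i) ->
    (forall i, 0 <= lam i) -> \sum_(i < n) lam i = 1 ->
    exists p : 'I_n -> R * R,
      (forall i, positive2 (p i) /\ slice2 N (f i) (alpha i) (p i)) /\
      N (\sum_(i < n) lam i *: p i) = 1.

(* Main.v *)
From HB Require Import structures.
Require Import Defs.
From mathcomp Require Import all_boot all_order all_algebra.
From mathcomp Require Import all_classical all_reals all_analysis.
From mathcomp Require Import ring lra.
Set Implicit Arguments.
Unset Strict Implicit.
Unset Printing Implicit Defensive.
Import Order.TTheory GRing.Theory Num.Theory.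
Import numFieldNormedType.Exports.
Local Open Scope classical_set_scope.
Local Open Scope ring_scope.

(** The strong diameter 2 property says that, given slices [S_i] of the unit
    ball and weights [lam_i], one can choose [x_i] in [S_i] with
    [`|\sum_i lam_i x_i|] as close to 1 as desired.  Indeed, of two points of
    the ball at distance almost 2, one has norm almost 1 ([sd2_norming]);
    conversely, one applies the norming property to the slices [S_i] together
    with the slices [- S_i], each with half of its weight ([sd2_of_norming]).

    A functional on the sum of [X] and [Y] is [z |-> f1 z.1 + f2 z.2], and its
    norm is the dual norm of the positive pair [(opnorm f1, opnorm f2)]
    ([opnorm_abs_sum]).  This pair is what links slices of the sum to slices
    of the plane.

    From the sum to the plane ([positive_sd2_of_abs_sum]): fix norm-one
    functionals [u], [v] and send [f_i = (c_i, d_i)] to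
    [z |-> c_i u(z.1) + d_i v(z.2)].  If [z_i] are almost norming points in the
    corresponding slices, then the pairs [(`|z_i.1|, `|z_i.2|)] lie in the plane
    slices, and [N] of their combination dominates [`|\sum_i lam_i z_i|] by the
    triangle inequality and monotonicity of [N].  This gives norm above
    [1 - eps] for every [eps]; the value 1 itself is reached by compactness
    ([norming_attained]).

    From the plane to the sum ([abs_sum_sd2]): let [(a_i, b_i)] be the points
    provided for the pairs of norms of the given functionals.  In [X], use the
    weights [lam_i a_i], and in [Y] the weights [lam_i b_i], to find norming
    [x_i] and [y_i] on which the two components of the functionals are almost
    maximal ([sd2_norming_weighted]).  The points [(a_i x_i, b_i y_i)] then lie
    in the slices, and their combination has norm almost
    [N (\sum_i lam_i (a_i, b_i)) = 1].

    Both directions need a norm-one functional on a nontrivial space.  It comes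
    from the Hahn-Banach theorem, proved through minimal sublinear
    functionals. *)

(** * Sublinear functionals and the Hahn-Banach theorem *)

Section Sublinear.
Context (R : realType) (V : lmodType R).
Implicit Types (p q : V -> R) (x y : V).

(** Homogeneity is required as an inequality only, which is easier to check on
    an infimum; equality follows by applying it to the inverse factor
    ([sublinearZ]). *)
Definition sublinear q :=
  (forall x y, q (x + y) <= q x + q y) /\
  (forall (t : R) x, 0 <= t -> q (t *: x) <= t * q x).

Lemma sublinear0 q : sublinear q -> q 0 = 0.
Proof.
move=> [qD qZ]; apply/eqP; rewrite eq_le; apply/andP; split.
  by have := qZ 0 0 (lexx _); rewrite scale0r mul0r.
by have := qD 0 0; rewrite addr0; lra.
Qed.

Lemma sublinearN q x : sublinear q -> - q (- x) <= q x.
Proof.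
move=> qs; have := qs.1 x (- x); rewrite subrr (sublinear0 qs); lra.
Qed.

Lemma sublinearZ q t x : sublinear q -> 0 <= t -> q (t *: x) = t * q x.
Proof.
move=> qs t0; have [->|tn0] := eqVneq t 0.
  by rewrite scale0r mul0r sublinear0.
have tp : 0 < t by rewrite lt_neqAle eq_sym tn0.
apply/eqP; rewrite eq_le qs.2 //=.
have := qs.2 t^-1 (t *: x); rewrite invr_ge0 t0 scalerA mulVf // scale1r.
by move=> /(_ isT); rewrite -ler_pdivlMl.
Qed.

(** The largest sublinear functional below [q] whose value at [- y] is at most
    [- q y]. *)
Definition sublinear_shift q y x : R :=
  inf [set q (x + t *: y) - t * q y | t in [set t | 0 <= t]].

Section Shift.
Context (q : V -> R) (y : V) (qs : sublinear q).
Local Notation qy := (sublinear_shift q y).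

Lemma sublinear_shift_le (t : R) x : 0 <= t -> qy x <= q (x + t *: y) - t * q y.
Proof.
move=> t0; apply: ge_inf; last by exists t.
exists (- q (- x)) => _ [s /= s0 <-].
have := qs.1 (x + s *: y) (- x); rewrite addrC addKr (sublinearZ _ qs) //; lra.
Qed.

Lemma sublinear_shift_ge (c : R) x :
  (forall t : R, 0 <= t -> c <= q (x + t *: y) - t * q y) -> c <= qy x.
Proof.
move=> h; apply: lb_le_inf => [|_ [t /= t0 <-]]; last exact: h.
by exists (q (x + 0 *: y) - 0 * q y); exists 0 => //=.
Qed.

Lemma sublinear_shift_le_id x : qy x <= q x.
Proof.
by have := sublinear_shift_le x (lexx 0); rewrite scale0r mul0r addr0 subr0.
Qed.

Lemma sublinear_shiftN : qy (- y) <= - q y.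
Proof.
have := sublinear_shift_le (- y) ler01.
by rewrite scale1r mul1r addNr (sublinear0 qs) sub0r.
Qed.

(** At two arguments, the shifts [t] and [s] are almost optimal for different
    parameters; their sum [t + s] serves for the sum of the arguments. *)
Lemma sublinear_shiftP : sublinear qy.
Proof.
split=> [x z|t x t0].
  rewrite -lerBlDr; refine (sublinear_shift_ge _) => t t0.
  rewrite lerBlDr -lerBlDl.
  refine (sublinear_shift_ge _) => s s0; rewrite lerBlDr.
  have ts0 : 0 <= t + s by exact: addr_ge0.
  apply: (le_trans (sublinear_shift_le _ ts0)).
  rewrite scalerDl addrACA; have := qs.1 (x + t *: y) (z + s *: y); lra.
have [->|tn0] := eqVneq t 0.
  by rewrite scale0r mul0r -(sublinear0 qs) sublinear_shift_le_id.
have tp : 0 < t by rewrite lt_neqAle eq_sym tn0.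
rewrite -ler_pdivrMl //; refine (sublinear_shift_ge _) => s s0.
rewrite ler_pdivrMl //.
apply: (le_trans (sublinear_shift_le _ (mulr_ge0 t0 s0))).
by rewrite -scalerA -scalerDr (sublinearZ _ qs) // mulrBr mulrA.
Qed.

End Shift.

(** Zorn's lemma: the pointwise infimum [m] of a chain is again sublinear.  In
    subadditivity the two summands may call for different members of the
    chain, and the smaller of the two works for both. *)
Lemma minimal_sublinear p : sublinear p ->
  exists q, [/\ sublinear q, forall x, q x <= p x &
    forall r, sublinear r -> (forall x, r x <= q x) -> forall x, q x <= r x].
Proof.
move=> ps; pose T := {q : V -> R | sublinear q /\ forall x, q x <= p x}.
pose t0 : T := exist _ p (conj ps (fun x => lexx (p x))).
pose le (a b : T) := `[< forall x, sval b x <= sval a x >].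
have [|||[q [qs qp]] qmin] := @ZL_preorder T t0 le.
- by move=> a; apply/asboolP => x.
- move=> b a c /asboolP ab /asboolP bc; apply/asboolP => x.
  exact: le_trans (bc x) (ab x).
- move=> A Atot; have [[a0 Aa0]|nA] := pselect (exists a, A a); last first.
    by exists t0 => a Aa; exfalso; apply: nA; exists a.
  pose m x := inf [set sval a x | a in A].
  have m_le a x : A a -> m x <= sval a x.
    move=> Aa; apply: ge_inf; last by exists a.
    exists (- p (- x)) => _ [b _ <-]; have [bs bp] := svalP b.
    by apply: le_trans (sublinearN _ bs); rewrite lerN2.
  have m_ge c x : (forall a, A a -> c <= sval a x) -> c <= m x.
    move=> h; apply: lb_le_inf => [|_ [a Aa <-]]; last exact: h.
    by exists (sval a0 x); exists a0.
  have ms : sublinear m.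
    split=> [x y|t x t0'].
      rewrite -lerBlDr; apply/m_ge => a Aa; rewrite lerBlDr -lerBlDl.
      apply/m_ge => b Ab; rewrite lerBlDl.
      have [/asboolP ab|/asboolP ba] := Atot _ _ Aa Ab.
        apply: (le_trans (m_le b _ Ab)); apply: (le_trans ((svalP b).1.1 _ _)).
        by rewrite lerD2r.
      apply: (le_trans (m_le a _ Aa)); apply: (le_trans ((svalP a).1.1 _ _)).
      by rewrite lerD2l.
    have [->|tn0] := eqVneq t 0.
      rewrite scale0r mul0r -(sublinear0 (svalP a0).1); exact: m_le.
    have tp : 0 < t by rewrite lt_neqAle eq_sym tn0.
    rewrite -ler_pdivrMl //; apply/m_ge => a Aa; rewrite ler_pdivrMl //.
    by apply: (le_trans (m_le a _ Aa)); exact: (svalP a).1.2.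
  have mp x : m x <= p x.
    exact: le_trans (m_le _ _ Aa0) ((svalP a0).2 x).
  exists (exist _ m (conj ms mp)) => a Aa; apply/asboolP => x /=; exact: m_le.
exists q; split=> // r rs rq x.
have rp z : r z <= p z by exact: le_trans (rq z) (qp z).
have /asboolP := qmin (exist _ r (conj rs rp)) (introT (asboolP _) rq).
exact.
Qed.

(** By minimality [q] lies below its own shift along [y], hence
    [q (- y) <= - q y].  So [q] is odd, and an odd sublinear functional is
    linear. *)
Lemma minimal_sublinear_linear q : sublinear q ->
  (forall r, sublinear r -> (forall x, r x <= q x) -> forall x, q x <= r x) ->
  linear (q : V -> R^o).
Proof.
move=> qs qmin.
have qN y : q (- y) = - q y.
  apply/eqP; rewrite eq_le; apply/andP; split.
    apply: le_trans (sublinear_shiftN y qs); apply: qmin.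
      exact: sublinear_shiftP.
    exact: sublinear_shift_le_id.
  by have := sublinearN y qs; lra.
have qD x y : q (x + y) = q x + q y.
  apply/eqP; rewrite eq_le qs.1 /=.
  by have := qs.1 (x + y) (- y); rewrite addrK qN; lra.
move=> t x y; rewrite qD; congr (_ + _); rewrite -[RHS]/(t * q x).
have [t0|t0] := leP 0 t; first exact: sublinearZ.
have -> : t *: x = - (- t *: x) by rewrite scaleNr opprK.
by rewrite qN sublinearZ // ?mulNr ?opprK // oppr_ge0 ltW.
Qed.

Definition linear_fun_of (f : V -> R^o) (Hf : linear f) : {linear V -> R^o} :=
  HB.pack f (GRing.isLinear.Build R V R^o *:%R f Hf).

Lemma hahn_banach p : sublinear p ->
  exists f : {linear V -> R^o}, forall x, f x <= p x.
Proof.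
move=> /minimal_sublinear[q [qs qp qmin]].
by exists (linear_fun_of (minimal_sublinear_linear qs qmin)).
Qed.

End Sublinear.

(** * Functionals on a normed space *)

Section Opnorm.
Context (R : realType) (X : completeNormedModType R).
Implicit Types f g : {linear X -> R^o}.

Lemma bound_continuous f (M : R) :
  (forall x, `|f x| <= M * `|x|) -> continuous f.
Proof.
move=> fM; apply/linear_bounded_continuous/linear_boundedP.
near=> r => x; apply: (le_trans (fM x)); rewrite ler_wpM2r //.
Unshelve. all: by end_near. Qed.

Lemma opnorm_le f (M : R) : (forall x, `|x| <= 1 -> `|f x| <= M) -> opnorm f <= M.
Proof.
move=> fM; apply: ge_sup => [|_ [x /= x1 <-]]; last exact: fM.
by exists `|f 0|; exists 0 => //=; rewrite normr0.
Qed.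

Lemma opnorm_has_sup f :
  continuous f -> has_sup [set `|f x| | x in [set x : X | `|x| <= 1]].
Proof.
move=> /linear_bounded_continuous/bounded_funP/(_ 1)[M fM]; split.
  by exists `|f 0|; exists 0 => //=; rewrite normr0.
by exists M => _ [x /= x1 <-]; exact: fM.
Qed.

Lemma le_opnorm1 f x : continuous f -> `|x| <= 1 -> `|f x| <= opnorm f.
Proof. by move=> fc x1; apply: ub_le_sup; [exact: (opnorm_has_sup fc).2|exists x]. Qed.

Lemma opnorm_ge0 f : continuous f -> 0 <= opnorm f.
Proof.
by move=> fc; have := le_opnorm1 (x := 0) fc; rewrite linear0 !normr0; apply; lra.
Qed.

Lemma le_opnorm f x : continuous f -> `|f x| <= opnorm f * `|x|.
Proof.
move=> fc; have [->|x0] := eqVneq x 0; first by rewrite linear0 !normr0 mulr0.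
have xp : 0 < `|x| by rewrite normr_gt0.
rewrite -ler_pdivrMr // mulrC -[X in X * _]ger0_norm ?invr_ge0 //.
rewrite -normrM; apply: (@le_trans _ _ `|f (`|x|^-1 *: x)|).
  by rewrite linearZ.
apply: le_opnorm1 => //; rewrite normrZ ger0_norm ?invr_ge0 //.
by rewrite mulVf // gt_eqF.
Qed.

Lemma opnormZ f g (c : R) : continuous g -> (forall x, f x = c * g x) ->
  0 <= c -> opnorm f = c * opnorm g.
Proof.
move=> gc fg c0; apply/eqP; rewrite eq_le; apply/andP; split.
  by apply: opnorm_le => x x1; rewrite fg normrM ger0_norm // ler_wpM2l // le_opnorm1.
have [->|cn0] := eqVneq c 0.
  rewrite mul0r; apply: opnorm_ge0; apply: (@bound_continuous _ (c * opnorm g)) => x.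
  by rewrite fg normrM ger0_norm // -mulrA ler_wpM2l // le_opnorm.
have cp : 0 < c by rewrite lt_neqAle eq_sym cn0.
rewrite -ler_pdivlMl //; apply: opnorm_le => x x1.
rewrite ler_pdivlMl // -[X in X * _]ger0_norm // -normrM -fg.
apply: le_opnorm1 => //; apply: (@bound_continuous _ (c * opnorm g)) => z.
by rewrite fg normrM ger0_norm // -mulrA ler_wpM2l // le_opnorm.
Qed.

Lemma opnorm_approx f (d : R) : continuous f -> 0 < d ->
  exists x, `|x| <= 1 /\ (1 - d) * opnorm f <= f x.
Proof.
move=> fc d0; have [f0|fn0] := eqVneq (opnorm f) 0.
  by exists 0; rewrite normr0 f0 mulr0 linear0.
have fp : 0 < opnorm f by rewrite lt_neqAle eq_sym fn0 opnorm_ge0.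
have [_ [x /= x1 <-] fx] := sup_adherent (mulr_gt0 d0 fp) (opnorm_has_sup fc).
have {}fx : (1 - d) * opnorm f <= `|f x| by move: fx; rewrite -/(opnorm f); lra.
have [fx0|fx0] := leP 0 (f x).
  by exists x; split => //; rewrite ger0_norm in fx.
by exists (- x); rewrite normrN linearN /=; split => //; rewrite ltr0_norm in fx.
Qed.

Lemma sublinear_norm : sublinear (fun x : X => `|x|).
Proof. by split=> [x y|t x t0]; [exact: ler_normD|rewrite normrZ ger0_norm]. Qed.

(** A linear functional below the norm has norm at most 1.  Taking it below the
    shift of the norm along [x0] forces [f x0 >= `|x0|], so its norm is 1. *)
Lemma exists_dual_sphere : nontrivial X -> exists f : {linear X -> R^o}, dual_sphere f.
Proof.
move=> [x0 x0n]; have [f fp] := hahn_banach (sublinear_shiftP x0 sublinear_norm).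
have fle x : f x <= `|x|.
  by apply: le_trans (fp x) _; exact: sublinear_shift_le_id sublinear_norm _.
have fabs x : `|f x| <= 1 * `|x|.
  rewrite mul1r ler_norml fle andbT lerNl -normrN; apply: le_trans (fle (- x)).
  by rewrite linearN.
have fc := bound_continuous fabs.
exists f; split=> //; apply/eqP; rewrite eq_le; apply/andP; split.
  by apply: opnorm_le => x x1; apply: le_trans (fabs x) _; rewrite mul1r.
have x0p : 0 < `|x0| by rewrite normr_gt0.
rewrite -(ler_pM2r x0p) mul1r; apply: le_trans (le_opnorm x0 fc).
apply: le_trans (ler_norm _).
have := fp (- x0); rewrite linearN => /le_trans /(_ (sublinear_shiftN _ sublinear_norm)).
by rewrite lerN2.
Qed.

(** When [f = 0] any norm-one functional serves for [g]; this lets a zero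
    functional be treated through slices as well. *)
Lemma opnorm_normalize f : nontrivial X -> continuous f ->
  exists2 g : {linear X -> R^o}, dual_sphere g & forall x, f x = opnorm f * g x.
Proof.
move=> X0 fc; have [f0|fn0] := eqVneq (opnorm f) 0.
  have [g gs] := exists_dual_sphere X0; exists g => // x.
  rewrite f0 mul0r; apply/eqP; rewrite -normr_le0.
  by apply: le_trans (le_opnorm x fc) _; rewrite f0 mul0r.
have fp : 0 < opnorm f by rewrite lt_neqAle eq_sym fn0 opnorm_ge0.
have lin : linear (fun x => (opnorm f)^-1 * f x : R^o).
  by move=> t x y; rewrite linearP /GRing.scale /=; ring.
pose g := linear_fun_of lin.
exists g; last by move=> x; rewrite /= mulVKf.
split; last by rewrite (@opnormZ g f (opnorm f)^-1) ?mulVf // invr_ge0 ltW.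
apply: (@bound_continuous _ 1) => x.
rewrite -[g x]/((opnorm f)^-1 * f x) normrM ger0_norm ?invr_ge0 ?(ltW fp) //.
rewrite ler_pdivrMl // mul1r.
exact: le_opnorm.
Qed.

End Opnorm.

(** * The strong diameter 2 property through norming points *)

Section StrongDiameter.
Context (R : realType) (X : completeNormedModType R).

(** Of two points of the ball at distance more than [2 - 2 eps], one has norm
    more than [1 - eps]. *)
Lemma sd2_norming (n : nat) (f : 'I_n -> {linear X -> R^o}) (alpha lam : 'I_n -> R)
    (eps : R) :
  strong_diam2 X -> (forall i, dual_sphere (f i)) -> (forall i, 0 < alpha i) ->
  (forall i, 0 <= lam i) -> \sum_(i < n) lam i = 1 -> 0 < eps ->
  exists x : 'I_n -> X, (forall i, slice (f i) (alpha i) (x i)) /\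
    1 - eps < `|\sum_(i < n) lam i *: x i|.
Proof.
move=> hX fs a0 l0 l1 e0.
pose C := minkowski_comb lam (fun i => slice (f i) (alpha i)).
have dC : diam C = 2%:E.
  apply: hX; exists n, lam, (fun i => slice (f i) (alpha i)).
  by do 3?split => //; move=> i; exists (f i), (alpha i).
have : ((2 - 2 * eps)%:E < diam C)%E by rewrite dC lte_fin; lra.
move=> /ereal_sup_gt[_ [[u v] [/= [x xS <-] [y yS <-]] <-]]; rewrite lte_fin.
move=> /lt_le_trans/(_ (ler_normB _ _)).
set u' := \sum_(i < n) lam i *: x i; set v' := \sum_(i < n) lam i *: y i => uv.
have [ltu|leu] := ltP (1 - eps) `|u'|; first by exists x.
by exists y; split => //; rewrite -/v'; lra.
Qed.

(** The norming points of the [2 n] slices of [f_i] and [- f_i], with weights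
    [lam_i / 2], are [x_i] and [- y_i] with [x_i], [y_i] in the slice of [f_i];
    their combination is half the difference of two points of the set. *)
Lemma sd2_of_norming :
  (forall (n : nat) (f : 'I_n -> {linear X -> R^o}) (alpha lam : 'I_n -> R) (eps : R),
    (forall i, dual_sphere (f i)) -> (forall i, 0 < alpha i) ->
    (forall i, 0 <= lam i) -> \sum_(i < n) lam i = 1 -> 0 < eps ->
    exists x : 'I_n -> X, (forall i, slice (f i) (alpha i) (x i)) /\
      1 - eps <= `|\sum_(i < n) lam i *: x i|) ->
  strong_diam2 X.
Proof.
move=> norming _ [n [lam [S [l0 [l1 [Ssl ->]]]]]].
have [f fP] := choice Ssl; have [alpha {}fP] := choice fP.
have lin i : linear (fun x => - f i x : R^o).
  by move=> t x y; rewrite linearP /GRing.scale /=; ring.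
pose g i := linear_fun_of (lin i).
have gs i : dual_sphere (g i).
  have [[fc f1] _] := fP i; split.
    apply: (@bound_continuous _ _ _ (opnorm (f i))) => x.
    by rewrite normrN le_opnorm.
  rewrite -f1; congr sup; apply/seteqP.
  by split=> _ [x x1 <-]; exists x => //=; rewrite normrN.
(* Indices below [n] carry the slices of [f], the others those of [- f]. *)
pose F (j : 'I_(n + n)) :=
  match fintype.split j with inl i => f i | inr i => g i end.
pose A (j : 'I_(n + n)) :=
  match fintype.split j with inl i => alpha i | inr i => alpha i end.
pose L (j : 'I_(n + n)) :=
  match fintype.split j with inl i => lam i / 2 | inr i => lam i / 2 end.
have splitl i : fintype.split (lshift n i) = inl i.
  exact: (unsplitK (inl i)).
have splitr i : fintype.split (rshift n i) = inr i.
  exact: (unsplitK (inr i)).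
apply/eqP; rewrite eq_le; apply/andP; split.
  apply: ge_ereal_sup => _ [[u v] [/= [x xS <-] [y yS <-]] <-]; rewrite lee_fin.
  have bnd (z : 'I_n -> X) : (forall i, S i (z i)) -> `|\sum_(i < n) lam i *: z i| <= 1.
    move=> zS; rewrite -l1; apply: (le_trans (ler_norm_sum _ _ _)).
    apply: ler_sum => i _; rewrite normrZ ger0_norm // ler_piMr //.
    by have := zS i; have [_ [_ ->]] := fP i; case.
  apply: le_trans (ler_normB _ _) _.
  by have := bnd _ xS; have := bnd _ yS; lra.
apply/lee_addgt0Pr => e e0.
have [||||| z [zS zn]] := norming _ F A L (e / 2).
- by move=> j; rewrite /F; case: fintype.split => i; [have [] := fP i|].
- by move=> j; rewrite /A; case: fintype.split => i; have [_ []] := fP i.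
- by move=> j; rewrite /L; case: fintype.split => i; rewrite divr_ge0.
- rewrite big_split_ord /=; under eq_bigr do rewrite /L splitl.
  under [X in _ + X]eq_bigr do rewrite /L splitr.
  by rewrite -mulr_suml l1; field.
- by rewrite divr_gt0.
pose x i := z (lshift n i); pose y i := - z (rshift n i).
have xS i : S i (x i).
  have [_ [_ ->]] := fP i; have := zS (lshift n i).
  by rewrite /F /A splitl.
have yS i : S i (y i).
  have [_ [_ ->]] := fP i; have := zS (rshift n i).
  by rewrite /F /A splitr /slice /= normrN linearN.
have zE : \sum_(j < n + n) L j *: z j =
    2^-1 *: (\sum_(i < n) lam i *: x i - \sum_(i < n) lam i *: y i).
  rewrite big_split_ord /= scalerBr; congr (_ + _).
    rewrite scaler_sumr; apply: eq_bigr => i _.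
    by rewrite /L splitl scalerA mulrC.
  rewrite -scalerN -sumrN scaler_sumr; apply: eq_bigr => i _.
  by rewrite /L splitr /y !scalerN opprK scalerA mulrC.
rewrite -leeBlDr //; apply: le_trans (ereal_sup_ubound _); last first.
  exists (\sum_(i < n) lam i *: x i, \sum_(i < n) lam i *: y i) => //.
  by split; [exists x|exists y].
rewrite -EFinB lee_fin /=.
move: zn; rewrite zE normrZ ger0_norm ?invr_ge0 //; lra.
Qed.

(** The form used for the coordinates of a sum: the functionals may be zero and
    the weights need not add up to 1, since after dividing by the total weight
    (or ignoring the weights when it is 0) one is back to slices. *)
Lemma sd2_norming_weighted (n : nat) (g : 'I_n -> {linear X -> R^o}) (d mu : 'I_n -> R)
    (eps : R) :
  nontrivial X -> strong_diam2 X -> (forall i, continuous (g i)) ->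
  (forall i, 0 < d i) -> (forall i, 0 <= mu i) -> 0 < eps ->
  exists x : 'I_n -> X,
    (forall i, `|x i| <= 1 /\ (1 - d i) * opnorm (g i) <= g i (x i)) /\
    (1 - eps) * (\sum_(i < n) mu i) <= `|\sum_(i < n) mu i *: x i|.
Proof.
move=> X0 hX gc d0 mu0 e0.
have [m0|mn0] := eqVneq (\sum_(i < n) mu i) 0.
  have [x xP] := choice (fun i => opnorm_approx (gc i) (d0 i)).
  by exists x; split => //; rewrite m0 mulr0.
have mp : 0 < \sum_(i < n) mu i by rewrite lt_neqAle eq_sym mn0 sumr_ge0.
set m := \sum_(i < n) mu i in mn0 mp *.
have hP i : exists h : {linear X -> R^o},
    dual_sphere h /\ forall x, g i x = opnorm (g i) * h x.
  by have [h hs hE] := opnorm_normalize X0 (gc i); exists h.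
have [h {}hP] := choice hP.
have [||||| x [xS xn]] := @sd2_norming n h d (fun i => mu i / m) eps hX => //.
- by move=> i; have [] := hP i.
- by move=> i; rewrite divr_ge0 // ltW.
- by rewrite -mulr_suml mulfV.
exists x; split => [i|].
  have [x1 /ltW xd] := xS i; split => //; rewrite (hP i).2 mulrC ler_wpM2l //.
  exact: opnorm_ge0.
have -> : \sum_(i < n) mu i *: x i = m *: \sum_(i < n) (mu i / m) *: x i.
  by rewrite scaler_sumr; apply: eq_bigr => i _; rewrite scalerA mulrC divfK.
by rewrite normrZ gtr0_norm // mulrC ler_wpM2l // ltW.
Qed.

End StrongDiameter.

(** * The dual of an absolute sum *)

Section DualNorm.
Context (R : realType) (N : abs_norm R).

Lemma dual_abs_norm_le (c d M : R) :
  (forall a b, 0 <= a -> 0 <= b -> N (a, b) <= 1 -> a * `|c| + b * `|d| <= M) ->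
  dual_abs_norm N (c, d) <= M.
Proof.
move=> h; apply: ge_sup => [|_ [[a b] /= ab <-]].
  exists (`|0 * c| + `|0 * d|); exists (0, 0) => //=.
  by rewrite (@abs_norm_l _ N 0).
by rewrite !normrM; apply: h => //; rewrite -abs_norm_absolute.
Qed.

Lemma le_dual_abs_norm (a b c d : R) : 0 <= a -> 0 <= b -> 0 <= c -> 0 <= d ->
  a * c + b * d <= dual_abs_norm N (c, d) * N (a, b).
Proof.
move=> a0 b0 c0 d0; have [N0|Nn0] := eqVneq (N (a, b)) 0.
  by rewrite N0 mulr0; have [-> ->] := abs_norm0_eq0 N0; rewrite !mul0r addr0.
have Np : 0 < N (a, b) by rewrite lt_neqAle eq_sym Nn0 abs_norm_ge0.
rewrite -ler_pdivrMr //; apply: ub_le_sup.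
  exists (c + d) => _ [[s t] /= st <-]; rewrite !normrM (ger0_norm c0) (ger0_norm d0).
  rewrite abs_norm_absolute in st; apply: lerD; apply: ler_piMl => //; apply: le_trans st.
    exact: abs_norm_ge_l.
  exact: abs_norm_ge_r.
exists ((N (a, b))^-1 *: (a, b)).
  by rewrite /= abs_normZ ger0_norm ?invr_ge0 ?abs_norm_ge0 // mulVf.
have Ni : 0 <= (N (a, b))^-1 by rewrite invr_ge0 abs_norm_ge0.
rewrite /= /GRing.scale /= ger0_norm ?(ger0_norm (x := _ * d)) ?mulr_ge0 //.
ring.
Qed.

End DualNorm.

Section Dual.
Context (R : realType) (N : abs_norm R) (X Y : completeNormedModType R).
Local Notation Z := (abs_sum N X Y : completeNormedModType R).

Lemma abs_sum_continuous (f : {linear Z -> R^o}) (f1 : {linear X -> R^o})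
    (f2 : {linear Y -> R^o}) :
  continuous f1 -> continuous f2 -> (forall z : Z, f z = f1 z.1 + f2 z.2) ->
  continuous f.
Proof.
move=> f1c f2c fE; apply: (@bound_continuous _ _ _ (opnorm f1 + opnorm f2)) => z.
rewrite fE; apply: (le_trans (ler_normD _ _)); rewrite mulrDl; apply: lerD.
  apply: le_trans (le_opnorm _ f1c) _; rewrite ler_wpM2l ?opnorm_ge0 //.
  exact: abs_norm_ge_l.
apply: le_trans (le_opnorm _ f2c) _; rewrite ler_wpM2l ?opnorm_ge0 //.
exact: abs_norm_ge_r.
Qed.

(** The supremum in the dual norm is approached by [(a *: x, b *: y)], where
    [x], [y] almost attain the norms of the components and [N (a, b) <= 1]:
    the components can be optimized independently because [N] only sees the
    norms. *)
Lemma opnorm_abs_sum (f : {linear Z -> R^o}) (f1 : {linear X -> R^o})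
    (f2 : {linear Y -> R^o}) :
  continuous f1 -> continuous f2 -> (forall z : Z, f z = f1 z.1 + f2 z.2) ->
  opnorm f = dual_abs_norm N (opnorm f1, opnorm f2).
Proof.
move=> f1c f2c fE; have fc := abs_sum_continuous f1c f2c fE.
have D0 : 0 <= dual_abs_norm N (opnorm f1, opnorm f2).
  have := @le_dual_abs_norm _ N 1 0 _ _ ler01 (lexx 0) (opnorm_ge0 f1c) (opnorm_ge0 f2c).
  by rewrite abs_norm10 mul0r addr0 mul1r mulr1; apply: le_trans; exact: opnorm_ge0.
apply/eqP; rewrite eq_le; apply/andP; split.
  apply: opnorm_le => z z1; rewrite fE.
  apply: (@le_trans _ _ (`|z.1| * opnorm f1 + `|z.2| * opnorm f2)).
    apply: (le_trans (ler_normD _ _)); rewrite ![`|_| * opnorm _]mulrC.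
    by apply: lerD; exact: le_opnorm.
  apply: (le_trans (le_dual_abs_norm N _ _ _ _)) => //; try exact: opnorm_ge0.
  exact: ler_piMr.
apply: dual_abs_norm_le => a b a0 b0 ab1.
rewrite !ger0_norm ?opnorm_ge0 //; set s := (X in X <= _).
have s0 : 0 <= s by rewrite addr_ge0 // mulr_ge0 // opnorm_ge0.
suff h (d : R) : 0 < d -> s - d * s <= opnorm f.
  apply/ler_addgt0Pr => e e0; have s1 : 0 < s + 1 by rewrite ltr_wpDl.
  have := h _ (divr_gt0 e0 s1); rewrite lerBlDr => /le_trans; apply.
  rewrite lerD2l mulrAC ler_pdivrMr // ler_wpM2l ?ltW //; lra.
move=> d0; have [x [x1 xf]] := opnorm_approx f1c d0.
have [y [y1 yf]] := opnorm_approx f2c d0.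
pose z : Z := (a *: x, b *: y).
have z1 : `|z| <= 1.
  apply: le_trans ab1; rewrite abs_sum_normE /= !normrZ !ger0_norm //.
  by apply: abs_norm_mono; rewrite ?mulr_ge0 // ler_piMr.
apply: le_trans (le_opnorm1 fc z1); apply: le_trans (ler_norm _).
have f1E : f1 (a *: x) = a * f1 x by rewrite linearZ.
have f2E : f2 (b *: y) = b * f2 y by rewrite linearZ.
rewrite fE f1E f2E /=.
have := ler_wpM2l a0 xf; have := ler_wpM2l b0 yf; rewrite /s; lra.
Qed.

Lemma abs_sum_split (f : {linear Z -> R^o}) : continuous f ->
  exists (f1 : {linear X -> R^o}) (f2 : {linear Y -> R^o}),
    [/\ continuous f1, continuous f2 & forall z : Z, f z = f1 z.1 + f2 z.2].
Proof.
move=> fc.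
have lin1 : linear (fun x : X => f ((x, 0) : Z) : R^o).
  move=> t x y; rewrite -linearP; congr (f _).
  by congr (_, _); rewrite /= scaler0 addr0.
have lin2 : linear (fun y : Y => f ((0, y) : Z) : R^o).
  move=> t x y; rewrite -linearP; congr (f _).
  by congr (_, _); rewrite /= scaler0 addr0.
exists (linear_fun_of lin1), (linear_fun_of lin2); split.
- apply: (@bound_continuous _ _ _ (opnorm f)) => x.
  apply: le_trans (le_opnorm _ fc) _.
  by rewrite abs_sum_normE /= normr0 abs_norm_l.
- apply: (@bound_continuous _ _ _ (opnorm f)) => x.
  apply: le_trans (le_opnorm _ fc) _.
  by rewrite abs_sum_normE /= normr0 abs_norm_r.
move=> [x y]; rewrite /= -linearD; congr (f _).
by congr (_, _); rewrite /= ?addr0 ?add0r.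
Qed.

End Dual.

(** * Attaining the norm in the plane *)

Lemma pair_sum (U V : nmodType) (n : nat) (w : 'I_n -> U * V) :
  \sum_(i < n) w i = (\sum_(i < n) (w i).1, \sum_(i < n) (w i).2).
Proof. by rewrite -!raddf_sum -surjective_pairing. Qed.

Section Compactness.
Context (R : realType) (N : abs_norm R).

Lemma abs_norm_dist (p q : R * R) : `|N p - N q| <= N (p - q).
Proof.
have Npq : N (q - p) = N (p - q).
  by rewrite -opprB -scaleN1r abs_normZ normrN normr1 mul1r.
rewrite ler_norml; apply/andP; split.
  by have := abs_normD N p (q - p); rewrite subrKC Npq; lra.
by have := abs_normD N (p - q) q; rewrite subrK; lra.
Qed.

Lemma abs_norm_continuous : continuous (N : R * R -> R).
Proof.
move=> p; apply/cvgrPdist_lt => e e0; near=> q.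
apply: le_lt_trans (abs_norm_dist p q) _.
have -> : p - q = (p.1 - q.1, p.2 - q.2) by [].
rewrite abs_norm_absolute; apply: le_lt_trans (abs_norm_le_add _ _ _) _ => //.
have le1 : `|p.1 - q.1| <= `|p - q| by rewrite /Num.norm /= le_max lexx.
have le2 : `|p.2 - q.2| <= `|p - q| by rewrite /Num.norm /= le_max lexx orbT.
suff : `|p - q| < e / 2 by lra.
near: q; apply: cvgr_dist_lt => //; exact: divr_gt0.
Unshelve. all: by end_near. Qed.

(** The positive part of a slice of the plane, closed by a non-strict
    inequality so as to be compact. *)
Definition slice2_section (f : R * R) (alpha : R) : set (R * R) :=
  [set p | positive2 p /\ N p <= 1 /\ 1 - alpha <= f.1 * p.1 + f.2 * p.2].

Lemma slice2_section_compact f alpha : compact (slice2_section f alpha).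
Proof.
have cmp : compact (`[0, 1]%classic `*` `[0, 1]%classic : set (R * R)).
  by apply: compact_setX; exact: segment_compact.
apply: subclosed_compact cmp _; last first.
  move=> [a b] [[/= a0 b0] [ab1 _]]; split => /=; rewrite in_itv /= ?a0 ?b0 /=.
    by apply: le_trans ab1; exact: abs_norm_ge_l.
  by apply: le_trans ab1; exact: abs_norm_ge_r.
have c1 : continuous (fst : R * R -> R) by move=> p; exact: cvg_fst.
have c2 : continuous (snd : R * R -> R) by move=> p; exact: cvg_snd.
have cl : continuous (fun p : R * R => f.1 * p.1 + f.2 * p.2).
  by move=> p; apply: cvgD; apply: cvgMr; [exact: c1|exact: c2].
have -> : slice2_section f alpha =
    (fst @^-1` [set x | 0 <= x] `&` snd @^-1` [set x | 0 <= x]) `&`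
    (N @^-1` [set x | x <= 1] `&`
     (fun p => f.1 * p.1 + f.2 * p.2) @^-1` [set x | 1 - alpha <= x]) by [].
have closedV (h : R * R -> R) (A : set R) : continuous h -> closed A -> closed (h @^-1` A).
  by move=> /continuous_closedP; exact.
apply: closedI; apply: closedI; apply: closedV => //.
exact: abs_norm_continuous.
Qed.

(** The norm of the combination is continuous on the product of the compact
    sets [slice2_section], hence attains its maximum there. *)
Lemma norming_attained (n : nat) (f : 'I_n -> R * R) (alpha lam : 'I_n -> R) :
  (forall eps, 0 < eps -> exists p : 'I_n -> R * R,
    (forall i, slice2_section (f i) (alpha i) (p i)) /\
    1 - eps <= N (\sum_(i < n) lam i *: p i)) ->
  exists p : 'I_n -> R * R,
    (forall i, slice2_section (f i) (alpha i) (p i)) /\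
    1 <= N (\sum_(i < n) lam i *: p i).
Proof.
move=> h; pose T := prod_topology (fun _ : 'I_n => (R * R)%type).
pose g (p : T) := N (\sum_(i < n) lam i *: p i).
have sc : continuous (fun p : T => \sum_(i < n) lam i *: p i).
  apply: continuous_big => [|i _ p]; first exact: add_continuous.
  apply: (continuous_comp (f := fun p : T => p i) (g := fun q : R * R => lam i *: q)).
    exact: (@proj_continuous _ (fun _ : 'I_n => (R * R)%type) i p).
  exact: scaler_continuous.
have gc : continuous g.
  by move=> p; apply: continuous_comp (sc p) _; exact: abs_norm_continuous.
have Kc : compact [set p : T | forall i, slice2_section (f i) (alpha i) (p i)].
  apply: (@tychonoff _ (fun _ : 'I_n => (R * R)%type)
    (fun i => slice2_section (f i) (alpha i))) => i.
  exact: slice2_section_compact.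
have [|p pK pmax] := compact_EVT_max _ Kc (continuous_subspaceT gc).
  by have [p [pK _]] := h 1 ltr01; exists p.
exists p; split; first by move: pK; rewrite inE.
apply/ler_addgt0Pr => e e0; have [q [qK qn]] := h e e0.
rewrite -lerBlDr; apply: le_trans qn _; apply: pmax; exact/mem_set.
Qed.

End Compactness.

(** * The two implications *)

Section Main.
Context (R : realType) (X Y : completeNormedModType R) (N : abs_norm R).
Context (X0 : nontrivial X) (Y0 : nontrivial Y).
Local Notation Z := (abs_sum N X Y : completeNormedModType R).

(** The points are sought in the slices of width [alpha i / 2], since passing to
    the limit in [norming_attained] turns the strict inequality of a slice into
    a non-strict one. *)
Lemma positive_sd2_of_abs_sum : strong_diam2 Z -> positive_strong_diam2 N.
Proof.
move=> hZ n f alpha lam fP a0 l0 l1.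
have [u [uc u1]] := exists_dual_sphere X0; have [v [vc v1]] := exists_dual_sphere Y0.
have a20 i : 0 < alpha i / 2 by rewrite divr_gt0.
have ulin i : linear (fun x => (f i).1 * u x : R^o).
  by move=> t x y; rewrite linearP /GRing.scale /=; ring.
have vlin i : linear (fun y => (f i).2 * v y : R^o).
  by move=> t x y; rewrite linearP /GRing.scale /=; ring.
have zlin i : linear (fun z : Z => (f i).1 * u z.1 + (f i).2 * v z.2 : R^o).
  move=> t x y.
  have uE : u (t *: x + y).1 = t * u x.1 + u y.1 := linearP u t x.1 y.1.
  have vE : v (t *: x + y).2 = t * v x.2 + v y.2 := linearP v t x.2 y.2.
  by rewrite uE vE -[t *: _]/(t * _); ring.
pose F i := linear_fun_of (zlin i).
have FS i : dual_sphere (F i).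
  have [f1 [fp1 fp2]] := fP i.
  have cu : continuous (linear_fun_of (ulin i)).
    apply: (@bound_continuous _ _ _ ((f i).1)) => x.
    rewrite normrM ger0_norm // ler_wpM2l //.
    by have := le_opnorm x uc; rewrite u1 mul1r.
  have cv : continuous (linear_fun_of (vlin i)).
    apply: (@bound_continuous _ _ _ ((f i).2)) => x.
    rewrite normrM ger0_norm // ler_wpM2l //.
    by have := le_opnorm x vc; rewrite v1 mul1r.
  have FE z : F i z = linear_fun_of (ulin i) z.1 + linear_fun_of (vlin i) z.2 by [].
  split; first exact: abs_sum_continuous cu cv FE.
  rewrite (opnorm_abs_sum cu cv FE) (opnormZ uc _ fp1) // (opnormZ vc _ fp2) //.
  by rewrite u1 v1 !mulr1 -surjective_pairing.
have [eps e0|p [pK pn]] := @norming_attained _ N n f (fun i => alpha i / 2) lam.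
  have [z [zS zn]] := sd2_norming hZ FS a20 l0 l1 e0.
  exists (fun i => (`|(z i).1|, `|(z i).2|)); split => [i|].
    have [z1 zf] := zS i; have [_ [fp1 fp2]] := fP i.
    split; first by split => /=.
    split; first by [].
    apply: le_trans (ltW zf) _; apply: lerD; apply: ler_wpM2l => //.
      apply: le_trans (ler_norm _) _.
      by have := le_opnorm (z i).1 uc; rewrite u1 mul1r.
    apply: le_trans (ler_norm _) _.
    by have := le_opnorm (z i).2 vc; rewrite v1 mul1r.
  apply: le_trans (ltW zn) _; rewrite abs_sum_normE.
  rewrite [X in _ <= N X]pair_sum; apply: abs_norm_mono => //=.
    rewrite (raddf_sum (@fst X Y)); apply: le_trans (ler_norm_sum _ _ _) _.
    by apply: ler_sum => i _; rewrite normrZ ger0_norm.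
  rewrite (raddf_sum (@snd X Y)); apply: le_trans (ler_norm_sum _ _ _) _.
  by apply: ler_sum => i _; rewrite normrZ ger0_norm.
exists p; split.
  move=> i; have [pp [p1 pf]] := pK i; split => //; split => //.
  by apply: lt_le_trans pf; have := a0 i; lra.
apply/eqP; rewrite eq_le pn andbT -l1.
elim/big_ind2 : _ => [|a p1 b p2 h1 h2|i _].
- by rewrite (@abs_norm_l _ N 0).
- by apply: le_trans (abs_normD _ _ _) _; exact: lerD.
by rewrite abs_normZ ger0_norm // ler_piMr //; have [_ []] := pK i.
Qed.

(** The loss in the choice of [x_i], [y_i] is controlled by two parameters: [d i]
    is small enough to stay in the [i]-th slice, and [e] bounds the loss in the
    norm of the combination. *)
Lemma abs_sum_sd2 : strong_diam2 X -> strong_diam2 Y ->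
  positive_strong_diam2 N -> strong_diam2 Z.
Proof.
move=> hX hY hN; apply: sd2_of_norming => n f alpha lam eps fS a0 l0 l1 e0.
have fsplit i : exists gg : {linear X -> R^o} * {linear Y -> R^o},
    [/\ continuous gg.1, continuous gg.2 & forall z : Z, f i z = gg.1 z.1 + gg.2 z.2].
  by have [g1 [g2 gP]] := abs_sum_split (fS i).1; exists (g1, g2).
have [g gP] := choice fsplit.
have gc1 i : continuous (g i).1 by have [] := gP i.
have gc2 i : continuous (g i).2 by have [] := gP i.
pose c i : R * R := (opnorm (g i).1, opnorm (g i).2).
have [|p [pS pn]] := hN n c alpha lam _ a0 l0 l1.
  move=> i; split; last by split; exact: opnorm_ge0.
  by have [h1 h2 h3] := gP i; rewrite -(opnorm_abs_sum h1 h2 h3) (fS i).2.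
pose v i := (c i).1 * (p i).1 + (c i).2 * (p i).2.
have v1 i : v i <= 1.
  have [[p1 p2] [pn1 _]] := pS i; apply: le_trans pn1.
  have := le_dual_abs_norm N p1 p2 (opnorm_ge0 (gc1 i)) (opnorm_ge0 (gc2 i)).
  have [h1 h2 h3] := gP i; rewrite -(opnorm_abs_sum h1 h2 h3) (fS i).2 mul1r.
  by rewrite -surjective_pairing /v /c /= !(mulrC (p i).1) !(mulrC (p i).2).
(* Half the room left in the slice; as [v i <= 1], a factor [1 - d i] costs at
   most [d i]. *)
pose d i := (v i - (1 - alpha i)) / 2.
have d0 i : 0 < d i by rewrite divr_gt0 // subr_gt0; have [_ []] := pS i.
have dP i : 1 - alpha i < (1 - d i) * v i.
  have := ler_wpM2l (ltW (d0 i)) (v1 i); have := d0 i; rewrite mulr1 mulrBl mul1r.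
  by rewrite {1 3}/d; lra.
(* The bound by 1 keeps [1 - e] nonnegative, so that monotonicity of [N]
   applies. *)
pose e := Num.min eps 1.
have ep : 0 < e by rewrite lt_min e0 ltr01.
have ee : e <= eps by rewrite ge_min lexx.
have e1 : e <= 1 by rewrite ge_min lexx orbT.
have l1p i : 0 <= lam i * (p i).1 by rewrite mulr_ge0 //; have [[]] := pS i.
have l2p i : 0 <= lam i * (p i).2 by rewrite mulr_ge0 //; have [[]] := pS i.
have [x [xP xn]] := sd2_norming_weighted X0 hX gc1 d0 l1p ep.
have [y [yP yn]] := sd2_norming_weighted Y0 hY gc2 d0 l2p ep.
pose z i : Z := ((p i).1 *: x i, (p i).2 *: y i).
exists z; split => [i|].
  have [[p1 p2] [pn1 pf]] := pS i; split.
    apply: le_trans pn1; rewrite abs_sum_normE /= !normrZ !ger0_norm //.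
    rewrite [X in _ <= N X]surjective_pairing.
    apply: abs_norm_mono; rewrite ?mulr_ge0 // ler_piMr //.
      by have [] := xP i.
    by have [] := yP i.
  apply: lt_le_trans (dP i) _; have [_ _ ->] := gP i.
  have E1 : (g i).1 ((p i).1 *: x i) = (p i).1 * (g i).1 (x i) by rewrite linearZ.
  have E2 : (g i).2 ((p i).2 *: y i) = (p i).2 * (g i).2 (y i) by rewrite linearZ.
  rewrite /= E1 E2; have [_ xg] := xP i; have [_ yg] := yP i.
  by have := ler_wpM2l p1 xg; have := ler_wpM2l p2 yg; rewrite /v /c /=; lra.
apply: (@le_trans _ _ (1 - e)); first by rewrite lerD2l lerN2.
have -> : 1 - e = N ((1 - e) *: (\sum_(i < n) lam i *: p i)).
  by rewrite abs_normZ pn mulr1 ger0_norm // subr_ge0.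
rewrite [X in N (_ *: X)]pair_sum abs_sum_normE /=; apply: abs_norm_mono => /=.
- by apply: mulr_ge0; [rewrite subr_ge0|apply: sumr_ge0 => i _; exact: l1p].
- rewrite (raddf_sum (@fst X Y)); apply: le_trans xn _.
  by under eq_bigr do rewrite -scalerA.
- by apply: mulr_ge0; [rewrite subr_ge0|apply: sumr_ge0 => i _; exact: l2p].
rewrite (raddf_sum (@snd X Y)); apply: le_trans yn _.
by under eq_bigr do rewrite -scalerA.
Qed.

End Main.

Theorem theorem3p5 (R : realType) (X Y : completeNormedModType R) (N : abs_norm R)
  (hX0 : nontrivial X) (hY0 : nontrivial Y)
  (hX : strong_diam2 X) (hY : strong_diam2 Y) :
  strong_diam2 (abs_sum N X Y) <-> positive_strong_diam2 N.
Proof.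
by split; [exact: positive_sd2_of_abs_sum|exact: abs_sum_sd2].
Qed.
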